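(* Let $n \ge 2$ be an integer. Let $A(n)$ be the real symmetric tridiagonal $n\times n$ matrix with diagonal entries $a_{ii} = n-1$ for $i=1,\dots,n$, and off-diagonal entries $$a_{i,i+1} = a_{i+1,i} = \tfrac12\sqrt{i(2n-i-1)} \quad (i=1,2,\dots,n-2), \qquad a_{n-1,n} = a_{n,n-1} = \sqrt{\frac{n(n-1)}{2}},$$ all other entries being zero. Let $A^o(n)$ be the $(n-1)\times(n-1)$ matrix obtained from $A(n)$ by deleting the last row and column. Then $A(n)$ has eigenvalues $\{0,2,\dots,2n-2\}$ and $A^o(n)$ has eigenvalues $\{1,3,\dots,2n-3\}$.
   Context: The sets of eigenvalues are the full spectra: $A(n)$ has the $n$ simple eigenvalues $2k$, $0\le k\le n-1$, and $A^o(n)$ has the $n-1$ simple eigenvalues $2l+1$, $0\le l\le n-2$. *)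

(* Defs.v *)
From mathcomp Require Import all_boot all_order all_algebra.

Set Implicit Arguments.
Unset Strict Implicit.
Unset Printing Implicit Defensive.

Import GRing.Theory Num.Theory.
Local Open Scope ring_scope.

(* The entry a_{i,i+1} = a_{i+1,i}, where i is counted from 1 to n - 1. *)
Definition offdiag (R : rcfType) (n i : nat) : R :=
  if i == n.-1 then Num.sqrt (n%:R * (n%:R - 1) / 2)
  else 2^-1 * Num.sqrt (i%:R * (2 * n%:R - i%:R - 1)).

(* Ordinals count from 0, so row i : 'I_n is the (i + 1)-st row. *)
Definition A (R : rcfType) (n : nat) : 'M[R]_n :=
  \matrix_(i, j)
    if i == j then n%:R - 1
    else if i.+1 == j :> nat then offdiag R n i.+1
    else if j.+1 == i :> nat then offdiag R n j.+1
    else 0.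

(* The widening 'I_n.-1 -> 'I_n misses only the last index, so this deletes the
   last row and column; unlike row' and col' it needs no cast to 'I_n.+1. *)
Definition Ao (R : rcfType) (n : nat) : 'M[R]_n.-1 :=
  mxsub (widen_ord (leq_pred n)) (widen_ord (leq_pred n)) (A R n).

(* Main.v *)
Require Import Defs.
From mathcomp Require Import all_boot all_order all_algebra.
From mathcomp Require Import ring lra zify.

Set Implicit Arguments.
Unset Strict Implicit.
Unset Printing Implicit Defensive.

Import GRing.Theory Num.Theory.
Local Open Scope ring_scope.

(* The (1 + 2d) x (1 + 2d) Kac-Sylvester matrix, with d = n - 1, has simple spectrum
   0, ..., 2d; its eigenvectors for l are given by the coefficients of the Krawtchouk
   generating polynomial K = (1 - X)^m (1 + X)^l, m = 2d - l.  A(n) and Ao(n) are its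
   restrictions to the symmetric and antisymmetric vectors.  Since the coefficient
   sequence of K is palindromic up to the sign (-1)^m, truncating it gives an
   eigenvector of A(n) when l is even (then K_(d+1) = K_(d-1)) and of Ao(n) when
   l is odd (then K_d = 0).  This produces as many distinct eigenvalues as the
   dimension, so they are all simple and there are no others. *)

(** * Coefficients of the Krawtchouk generating polynomial: recurrence and symmetry *)

Section Krawtchouk.
Variable R : comNzRingType.

Definition krawtchouk (m l : nat) : {poly R} := (1 - 'X) ^+ m * (1 + 'X) ^+ l.

(** The factor [p] restores the exponent lowered by differentiation, so no [k.-1] appears and
    [k = 0] is covered. *)
Lemma mul_deriv_exp (p : {poly R}) k : p * (p ^+ k)^`() = k%:R * p^`() * p ^+ k.
Proof.
rewrite deriv_exp; case: k => [|k]; first by rewrite mulr0n mulr0 !mul0r.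
by rewrite /= exprS -mulr_natl; ring.
Qed.

(* Comparing coefficients in (1 - X^2) K' = (l - m - (m + l) X) K. *)
Lemma krawtchouk_rec m l j :
  j.+1%:R * (krawtchouk m l)`_j.+1 = (l%:R - m%:R) * (krawtchouk m l)`_j
  - (0 < j)%:R * (m%:R + l%:R + 1 - j%:R) * (krawtchouk m l)`_j.-1.
Proof.
set K := krawtchouk m l.
(* The differential equation solved for [K'], with powers of ['X] as nested products, so that each
   term's coefficients are index shifts. *)
have E : K^`() = 'X * ('X * K^`()) + (l%:R - m%:R) * K - (m%:R + l%:R) * ('X * K).
  have Em := mul_deriv_exp (1 - 'X) m; have El := mul_deriv_exp (1 + 'X) l.
  rewrite derivB derivC derivX sub0r in Em; rewrite derivD derivC derivX add0r in El.
  have D : K^`() = ((1 - 'X) ^+ m)^`() * (1 + 'X) ^+ l + (1 - 'X) ^+ m * ((1 + 'X) ^+ l)^`().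
    exact: derivM.
  have : (1 - 'X) * (1 + 'X) * K^`() = (l%:R - m%:R - (m%:R + l%:R) * 'X) * K.
    rewrite D /K /krawtchouk; move: Em El.
    move: ((1 - 'X) ^+ m) ((1 + 'X) ^+ l) => P Q Em El.
    transitivity ((1 + 'X) * Q * ((1 - 'X) * P^`()) + (1 - 'X) * P * ((1 + 'X) * Q^`())); first by ring.
    by rewrite Em El; ring.
  by move=> H; apply/eqP; rewrite -subr_eq0; apply/eqP; move/eqP: H; rewrite -subr_eq0 => /eqP <-; ring.
have : K^`()`_j = ('X * ('X * K^`()) + (l%:R - m%:R)%:P * K - (m%:R + l%:R)%:P * ('X * K))`_j.
  by rewrite polyCB polyCD !polyC_natr -E.
have dK i : K^`()`_i = i.+1%:R * K`_i.+1 by rewrite coef_deriv mulr_natl.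
rewrite !(coefB, coefD, coefCM, coefXM) !dK.
case: j => [|[|i]] /= ->; first by ring.
  by ring.
by rewrite -[i.+2]addn1 -[i.+1]addn1 !natrD; ring.
Qed.

(** The factor [1 + e X] is itself palindromic up to the sign [e], and signs multiply.
    [krawtchouk_sym] adds its linear factors one at a time this way. *)
Lemma palindrome_mul (d : nat) (s e : R) (p : {poly R}) :
  e * e = 1 -> (size p <= d.+1)%N ->
  (forall i j, (i + j = d)%N -> p`_i = s * p`_j) ->
  forall i j, (i + j = d.+1)%N ->
  (p * (1 + e *: 'X))`_i = (s * e) * (p * (1 + e *: 'X))`_j.
Proof.
move=> e2 sp pal i j ij; rewrite mulrDr mulr1 -scalerAr !coefD !coefZ !coefMX.
have z k : (d < k)%N -> p`_k = 0 by move=> dk; rewrite nth_default // (leq_trans sp).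
case: i j ij => [|i] [|j] //= ij.
- have -> : j = d by lia.
  by rewrite (z d.+1) // (pal 0%N d) //; ring: e2.
- have -> : i = d by lia.
  by rewrite (z d.+1) // (pal d 0%N) ?addn0 //; ring.
rewrite (pal i.+1 j) 1?(pal i j.+1); try lia.
by ring: e2.
Qed.

Lemma size_exp_linear (p : {poly R}) k :
  (size p <= 2)%N -> (size (p ^+ k) <= k.+1)%N.
Proof.
move=> sp; apply: leq_trans (size_poly_exp_leq _ _) _.
by rewrite ltnS -[leqRHS]mul1n leq_mul2r -subn1 leq_subLR sp orbT.
Qed.

Lemma krawtchouk_size m l : (size (krawtchouk m l) <= (m + l).+1)%N.
Proof.
have s1 : (size (1 - 'X : {poly R})%R <= 2)%N.
  by rewrite -opprB size_polyN -polyC1 size_XsubC.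
have s2 : (size (1 + 'X : {poly R})%R <= 2)%N by rewrite addrC -polyC1 size_XaddC.
apply: leq_trans (size_polyMleq _ _) _.
have sm := size_exp_linear m s1; have sl := size_exp_linear l s2.
by rewrite -subn1 leq_subLR (leq_trans (leq_add sm sl)) // addSn addnS.
Qed.

Lemma krawtchouk_sym m l i j : (i + j = m + l)%N ->
  (krawtchouk m l)`_i = (-1) ^+ m * (krawtchouk m l)`_j.
Proof.
elim: l i j => [|l IHl] i j.
  rewrite addn0; elim: m i j => [|m IHm] i j.
    by case: i j => [|i] [|j] // _; rewrite mul1r.
  have -> : krawtchouk m.+1 0 = krawtchouk m 0 * (1 + (-1) *: 'X).
    by rewrite /krawtchouk exprS scaleN1r; ring.
  move=> ij; rewrite exprSr.
  apply: (@palindrome_mul m) => //; first by rewrite mulrNN mulr1.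
  by have := krawtchouk_size m 0; rewrite addn0.
have -> : krawtchouk m l.+1 = krawtchouk m l * (1 + 1 *: 'X).
  by rewrite /krawtchouk exprS scale1r; ring.
rewrite addnS => ij; rewrite -[(-1) ^+ m]mulr1.
by apply: (@palindrome_mul (m + l)); rewrite ?mulr1 ?krawtchouk_size.
Qed.

Lemma krawtchouk0 m l : (krawtchouk m l)`_0 = 1.
Proof. by rewrite -horner_coef0 /krawtchouk !hornerE ?subr0 ?addr0 !expr1n ?mulr1. Qed.

End Krawtchouk.

(** * Eigenvectors of tridiagonal matrices from three-term recurrences *)

Section Tridiagonal.
Variable F : fieldType.

Definition tridiag (m : nat) (a : F) (b : nat -> F) : 'M[F]_m :=
  \matrix_(i, j)
    if i == j then a
    else if i.+1 == j :> nat then b i.+1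
    else if j.+1 == i :> nat then b j.+1
    else 0.

(* The eigenvector has entries p i / (b 1 * ... * b i). At i = 0 the junk value
   p i.-1 = p 0 is multiplied by 0. *)
Lemma tridiag_eigenvalue (m : nat) (a x : F) (b p : nat -> F) :
  (0 < m)%N -> (forall i, (0 < i < m)%N -> b i != 0) -> p 0%N != 0 ->
  (forall i, (i < m)%N ->
    (x - a) * p i = (0 < i)%:R * b i ^+ 2 * p i.-1 + (i.+1 < m)%:R * p i.+1) ->
  eigenvalue (tridiag m a b) x.
Proof.
move=> m0 bN0 p0 rec; pose c i := \prod_(1 <= k < i.+1) b k.
have cS i : c i.+1 = c i * b i.+1 by rewrite /c big_nat_recr.
have cN0 i : (i < m)%N -> c i != 0.
  move=> im; rewrite /c prodf_seq_neq0; apply/allP => k; rewrite mem_index_iota => /andP[k0 ki].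
  by apply/implyP => _; apply: bN0; lia.
apply/eigenvalueP; exists (\row_(i < m) (p i / c i)); last first.
  apply/negP => /eqP/rowP/(_ (Ordinal m0)); rewrite !mxE /= => /eqP.
  by rewrite mulf_eq0 invr_eq0 (negPf p0) (negPf (cN0 0%N m0)).
apply/rowP => i; rewrite !mxE.
(* Column [i] meets only the rows [i], [i.-1] and [i.+1]. The guard [0 < i] is needed because
   [0.-1 = 0] would count the diagonal entry again. *)
have split3 (j : 'I_m) : (\row_(i < m) (p i / c i)) 0 j * tridiag m a b j i =
    (if j == i :> nat then p j / c j * a else 0)
  + (if (0 < i)%N && (j == i.-1 :> nat) then p j / c j * b i else 0)
  + (if j == i.+1 :> nat then p j / c j * b j else 0).
  rewrite !mxE -val_eqE /=.
  have [ji|nji] := eqVneq (j : nat) i.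
    have -> : (0 < i)%N && (j == i.-1 :> nat) = false by lia.
    have -> : (j == i.+1 :> nat) = false by lia.
    by rewrite !addr0.
  have [ji|nji1] := eqVneq j.+1 (i : nat).
    have -> : (0 < i)%N && (j == i.-1 :> nat) = true by lia.
    have -> : (j == i.+1 :> nat) = false by lia.
    by rewrite ji addr0 add0r.
  have -> : (0 < i)%N && (j == i.-1 :> nat) = false by lia.
  have [ji|nji2] := eqVneq i.+1 (j : nat).
    by rewrite -ji !add0r.
  by rewrite !addr0 mulr0.
rewrite (eq_bigr _ (fun j _ => split3 j)) !big_split /= -!big_mkcond /=.
rewrite (big_ord1_eq _ (fun j => p j / c j * a)) ltn_ord.
rewrite (big_ord1_eq _ (fun j => p j / c j * b j)).
have -> : \sum_(j < m | (0 < i)%N && (j == i.-1 :> nat)) p j / c j * b i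
    = (0 < i)%:R * (p i.-1 / c i.-1 * b i).
  case: (posnP i) => [->|i0] /=; first by rewrite big_pred0 // mul0r.
  rewrite (big_ord1_eq _ (fun j => p j / c j * b i)) ifT ?mul1r //.
  by have := ltn_ord i; lia.
have ci := cN0 i (ltn_ord i).
have -> : x * (p i / c i) = a * (p i / c i) + ((x - a) * p i) / c i by ring.
(* By [cS], dividing by [c i] turns [b i ^+ 2] into [b i] over [c i.-1], and [p i.+1] acquires the
   factor [b i.+1] over [c i.+1]. *)
rewrite rec // mulrDl [p i / c i * a]mulrC -addrA; congr (_ + (_ + _)).
  case: (posnP i) => [->|i0]; first by rewrite !mul0r.
  rewrite !mul1r; have := cS i.-1; rewrite prednK // => ic.
  have := ci; rewrite ic mulf_eq0 negb_or => /andP[c1 b1].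
  by field; rewrite c1 b1.
case: ifP => im; last by rewrite !mul0r.
have := cN0 i.+1 im; rewrite cS mulf_eq0 negb_or => /andP[c1 b1].
by rewrite mul1r; field; rewrite c1 b1.
Qed.
End Tridiagonal.

(** * Simple spectra from as many distinct eigenvalues as the dimension *)

Lemma char_poly_distinct_eigenvalues (F : fieldType) m (M : 'M[F]_m) (s : seq F) :
  size s = m -> uniq s -> all (eigenvalue M) s ->
  char_poly M = \prod_(y <- s) ('X - y%:P).
Proof.
move=> sm us es; have sz : size (char_poly M) = (size s).+1 by rewrite size_char_poly sm.
rewrite (all_roots_prod_XsubC sz) ?uniq_rootsE //; last first.
  by apply/allP => y /(allP es); rewrite eigenvalue_root_char.
by rewrite (monicP (char_poly_monic M)) scale1r.
Qed.

(** In characteristic 0 the values [f k] stay distinct, so the characteristic polynomial is the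
    product of the ['X - f k]; roots and multiplicities are read off from it. *)
Lemma simple_spectrum (R : numFieldType) m (M : 'M[R]_m.+1) (f : nat -> nat) :
  injective f -> (forall k, (k <= m)%N -> eigenvalue M (f k)%:R) ->
  (forall x, eigenvalue M x <-> exists2 k, (k <= m)%N & x = (f k)%:R) /\
  (forall x, eigenvalue M x -> mup x (char_poly M) = 1%N).
Proof.
move=> finj fM; pose s : seq R := [seq (f k)%:R | k <- iota 0 m.+1].
have us : uniq s.
  rewrite map_inj_uniq ?iota_uniq // => k l /eqP.
  by rewrite eqr_nat => /eqP /finj.
have ss x : reflect (exists2 k, (k <= m)%N & x = (f k)%:R) (x \in s).
  apply: (iffP mapP) => -[k]; rewrite ?mem_iota => km ->; exists k => //.
  by rewrite mem_iota.
have cM : char_poly M = \prod_(y <- s) ('X - y%:P).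
  apply: char_poly_distinct_eigenvalues => //; first by rewrite size_map size_iota.
  by apply/allP => _ /ss[k km ->]; exact: fM.
have eM x : eigenvalue M x = (x \in s).
  by rewrite eigenvalue_root_char cM root_prod_XsubC.
split=> x; first by rewrite eM; split=> /ss.
by rewrite eM cM mu_prod_XsubC count_uniq_mem // => ->.
Qed.

(** * The even and odd eigenvalues, with [d = n - 1] *)

Section Eigenvalues.
Variable R : rcfType.
Variable d : nat.

Let b := offdiag R d.+1.

Lemma offdiag_sqr i : (0 < i < d)%N -> b i ^+ 2 = i%:R * (2 * d%:R + 1 - i%:R) / 4.
Proof.
move=> /andP[i0 id]; rewrite /b /offdiag /= ltn_eqF // exprMn sqr_sqrtr.
  by rewrite -addn1 natrD; field.
move: id; rewrite -(ltr_nat R) => id.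
by apply: mulr_ge0; rewrite ?ler0n // -addn1 natrD; have := ler0n R d; lra.
Qed.

Lemma offdiag_last_sqr : b d ^+ 2 = d.+1%:R * d%:R / 2.
Proof.
rewrite /b /offdiag eqxx -{2}addn1 natrD addrK sqr_sqrtr //.
by rewrite divr_ge0 ?mulr_ge0 ?ler0n.
Qed.

Lemma offdiag_neq0 i : (0 < i <= d)%N -> b i != 0.
Proof.
move=> /andP[i0 id]; rewrite -sqrf_eq0.
have i0R : 0 < i%:R :> R by rewrite ltr0n.
move: id; rewrite leq_eqVlt => /predU1P[iE|id].
  rewrite iE in i0R *; rewrite offdiag_last_sqr.
  by apply: lt0r_neq0; rewrite divr_gt0 ?mulr_gt0 ?ltr0Sn.
rewrite offdiag_sqr ?i0 //; apply: lt0r_neq0.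
have : i%:R < d%:R :> R by rewrite ltr_nat.
by move=> idR; rewrite divr_gt0 ?ltr0n // mulr_gt0 //; have := ler0n R d; lra.
Qed.

(* When m + l = 2 d and j <= d, this is the j-th leading principal minor of
   l%:R%:M - A, in closed form. *)
Definition jacobi_value (m l j : nat) : R :=
  j`!%:R / 2 ^+ j * (krawtchouk R m l)`_j.

(** This is [krawtchouk_rec] times [i! / 2^(i+1)], with [l - m = 2 (l - d)]. The scaling makes the
    coefficient of the [i.-1] term equal to [b i ^+ 2] for [0 < i < d]. *)
Lemma jacobi_value_rec m l i : (m + l = 2 * d)%N ->
  (l%:R - d%:R) * jacobi_value m l i =
  (0 < i)%:R * (i%:R * (2 * d%:R + 1 - i%:R) / 4) * jacobi_value m l i.-1
  + jacobi_value m l i.+1.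
Proof.
move=> mld; have mldR : m%:R + l%:R = 2 * d%:R :> R by rewrite -natrD mld natrM.
have p2 j : 2 ^+ j != 0 :> R by rewrite expf_neq0 ?pnatr_eq0.
have := krawtchouk_rec R m l i; rewrite mldR.
rewrite (_ : m%:R = 2 * d%:R - l%:R) => [E|]; last by rewrite -mldR addrK.
have -> : jacobi_value m l i.+1 =
    i`!%:R / 2 ^+ i.+1 * (i.+1%:R * (krawtchouk R m l)`_i.+1).
  by rewrite /jacobi_value factS natrM; ring.
rewrite E /jacobi_value; case: i {E} => [|i] /=.
  by rewrite exprS !mul0r; field.
by rewrite factS natrM !exprS !mul1r; field; rewrite p2.
Qed.

Lemma jacobi_value0 m l : jacobi_value m l 0 != 0.
Proof. by rewrite /jacobi_value krawtchouk0 expr0 divr1 mulr1 oner_neq0. Qed.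

Lemma tridiag_even_eigenvalue k : (0 < d)%N -> (k <= d)%N ->
  eigenvalue (tridiag d.+1 d%:R b) (2 * k)%:R.
Proof.
move=> d0 kd; set m := (2 * (d - k))%N; set l := (2 * k)%N.
have mld : (m + l = 2 * d)%N by rewrite /m /l; lia.
apply: (tridiag_eigenvalue (p := jacobi_value m l)) => //.
- by move=> i /andP[i0 id]; apply: offdiag_neq0; rewrite i0.
- exact: jacobi_value0.
move=> i; rewrite ltnS leq_eqVlt => /predU1P[->|id]; last first.
  rewrite jacobi_value_rec // ltnS id mul1r; congr (_ + _).
  by case: (posnP i) => [->|i0]; rewrite ?mul0r // offdiag_sqr ?i0.
rewrite ltnn mul0r addr0 offdiag_last_sqr d0 mul1r.
(* As [m] is even, the term beyond the last row folds back onto index [d.-1]. It doubles the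
   coefficient [d (d + 1) / 4] there, which gives exactly the exceptional [b d ^+ 2]. *)
have E : jacobi_value m l d.+1 = d.+1%:R * d%:R / 4 * jacobi_value m l d.-1.
  rewrite /jacobi_value (@krawtchouk_sym _ m l d.+1 d.-1); last by lia.
  rewrite /m mul2n -signr_odd odd_double expr0 mul1r -/m.
  have -> : d.+1`!%:R / 2 ^+ d.+1 =
      d.+1%:R * d%:R / 4 * (d.-1`!%:R / 2 ^+ d.-1) :> R.
    rewrite -(prednK d0) /= !factS !natrM !exprS.
    by field; rewrite expf_neq0 ?pnatr_eq0.
  by rewrite !mulrA.
by rewrite (jacobi_value_rec d mld) E d0 mul1r -addn1 natrD; field.
Qed.

(** The exceptional entry [b d] lies outside this block, so [jacobi_value_rec] fits every row once
    the term at index [d] vanishes. *)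
Lemma tridiag_odd_eigenvalue k : (k < d)%N ->
  eigenvalue (tridiag d d%:R b) (2 * k + 1)%:R.
Proof.
move=> kd; set m := (2 * (d - k.+1) + 1)%N; set l := (2 * k + 1)%N.
have mld : (m + l = 2 * d)%N by rewrite /m /l; lia.
apply: (tridiag_eigenvalue (p := jacobi_value m l)) => //; first by lia.
- by move=> i /andP[i0 id]; apply: offdiag_neq0; rewrite i0 ltnW.
- exact: jacobi_value0.
(* As [m] is odd, the symmetry at the middle index [d] reads [K_d = - K_d]. *)
have Kd : jacobi_value m l d = 0.
  have := @krawtchouk_sym R m l d d; rewrite mld mul2n addnn => /(_ erefl).
  rewrite /m -signr_odd mul2n addn1 /= odd_double /= expr1 mulN1r /jacobi_value.
  by move=> K; rewrite (_ : _`_d = 0) ?mulr0 //; move: K; set z := _`_d; lra.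
move=> i id; rewrite jacobi_value_rec //; congr (_ + _).
  by case: (posnP i) => [->|i0]; rewrite ?mul0r // offdiag_sqr ?i0.
by move: id; rewrite leq_eqVlt => /predU1P[->|->]; rewrite ?mul1r // Kd mulr0.
Qed.

End Eigenvalues.

Theorem theorem2p1 (R : rcfType) (n : nat) (hn : (2 <= n)%N) :
  [/\ forall x : R, eigenvalue (A R n) x <->
        exists2 k : nat, (k <= n - 1)%N & x = (2 * k)%:R,
      forall x : R, eigenvalue (A R n) x -> mup x (char_poly (A R n)) = 1%N,
      forall x : R, eigenvalue (Ao R n) x <->
        exists2 l : nat, (l <= n - 2)%N & x = (2 * l + 1)%:R &
      forall x : R, eigenvalue (Ao R n) x -> mup x (char_poly (Ao R n)) = 1%N].
Proof.
(* From here [d] is [n.+1]: the two matrices are tridiagonal of sizes [d.+1] and [d], with the same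
   diagonal value and the same [offdiag]. *)
case: n hn => [|[|n]] // _; rewrite subn1 subn2 /=.
have aE : n.+2%:R - 1 = n.+1%:R :> R by rewrite -addn1 natrD addrK.
have AE : A R n.+2 = tridiag n.+2 n.+1%:R (offdiag R n.+2).
  by apply/matrixP => i j; rewrite !mxE aE.
have AoE : Ao R n.+2 = tridiag n.+1 n.+1%:R (offdiag R n.+2).
  by apply/matrixP => i j; rewrite !mxE aE -!val_eqE.
have [|k kn|A1 A2] := @simple_spectrum R n.+1 (A R n.+2) (fun k => 2 * k)%N.
- by move=> k l /=; lia.
- by rewrite AE; apply: tridiag_even_eigenvalue.
have [|k kn|Ao1 Ao2] := @simple_spectrum R n (Ao R n.+2) (fun k => 2 * k + 1)%N.
- by move=> k l /=; lia.
- by rewrite AoE; apply: tridiag_odd_eigenvalue.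
by split.
Qed.
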